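(* For every integer $r\geq 2$, with $p=p(n)\in[0,1]$: (i) if $p=\left(\frac{r\log n-\omega(1)}{n}\right)^{1/r}$ (where $\omega(1)$ denotes some function of $n$ tending to infinity), then asymptotically almost surely $\mathrm{tc}_r(G(n,p))> r$; (ii) if $p = o\left( \left(\frac{r\log n}{n}\right)^{1/r}\right)$, then asymptotically almost surely $\mathrm{tc}_r(G(n,p))\to \infty$, that is, for every constant $K$, $\Pr[\mathrm{tc}_r(G(n,p))>K]\to 1$ as $n\to\infty$.
   Context: $G(n,p)$ is the binomial random graph on $n$ vertices in which each pair is an edge independently with probability $p=p(n)$. A sequence of events $A_n$ holds asymptotically almost surely if $\Pr[A_n]\to 1$ as $n\to\infty$. $\log$ is the natural logarithm. The $r$-color tree-cover number $\mathrm{tc}_r(G)$ is the minimum $s$ such that for every $r$-coloring of the edges of $G$ (an arbitrary assignment of one of $r$ colors to each edge) there exists a collection of monochromatic connected subgraphs $\{H_1,\dots,H_t\}$ with $t\leq s$ such that $V(H_1)\cup\dots\cup V(H_t)=V(G)$. (A single vertex counts as a monochromatic connected subgraph.) *)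

(* Defs.v *)
From HB Require Import structures.
From mathcomp Require Import all_boot all_order all_algebra.

Set Implicit Arguments.
Unset Strict Implicit.
Unset Printing Implicit Defensive.

Import Order.TTheory GRing.Theory Num.Theory.

Local Open Scope ring_scope.

Definition vpairs (T : finType) : {set {set T}} :=
  [set e : {set T} | #|e| == 2%N].

Record sgraph (T : finType) := SGraph {
  edges : {set {set T}};
  edges_sub : edges \subset vpairs T }.

HB.instance Definition _ (T : finType) := [isSub for @edges T].
HB.instance Definition _ (T : finType) := [Countable of sgraph T by <:].
HB.instance Definition _ (T : finType) := [Finite of sgraph T by <:].

Section TreeCover.
Variables (T : finType) (r : nat) (G : sgraph T).

(* A candidate subgraph is a pair H = (V(H), E(H)). *)
Definition is_subgraph (H : {set T} * {set {set T}}) : bool :=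
  (H.2 \subset edges G) && [forall e in H.2, e \subset H.1].

Definition connected_graph (H : {set T} * {set {set T}}) : bool :=
  (H.1 != set0) &&
  [forall x in H.1, forall y in H.1,
     connect [rel u v | [set u; v] \in H.2] x y].

(* An edge coloring is represented by a total function on {set T}; its values
   outside [edges G] are never looked at. *)
Definition monochromatic (c : {ffun {set T} -> 'I_r})
    (H : {set T} * {set {set T}}) : bool :=
  [exists i : 'I_r, [forall e in H.2, c e == i]].

Definition mono_cover (c : {ffun {set T} -> 'I_r})
    (C : {set {set T} * {set {set T}}}) : bool :=
  [forall H in C, [&& is_subgraph H, connected_graph H & monochromatic c H]] &&
  (\bigcup_(H in C) H.1 == [set: T]).

Definition tree_coverable (s : nat) : bool :=
  [forall c : {ffun {set T} -> 'I_r},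
    [exists C : {set {set T} * {set {set T}}},
      (#|C| <= s)%N && mono_cover c C]].

Lemma tree_coverable_ex : exists s, tree_coverable s.
Proof.
exists #|[set ([set x], set0 : {set {set T}}) | x in T]|.
apply/forallP => c; apply/existsP.
exists [set ([set x], set0 : {set {set T}}) | x in T].
rewrite leqnn /=; apply/andP; split.
- apply/forall_inP => _ /imsetP[x _ ->]; apply/and3P; split.
  + rewrite /is_subgraph /= sub0set /=.
    by apply/forall_inP => e; rewrite inE.
  + apply/andP; split; first by apply/set0Pn; exists x; rewrite inE.
    apply/forall_inP => y /set1P ->; apply/forall_inP => z /set1P ->.
    exact: connect0.
  + apply/existsP; exists (c set0).
    by apply/forall_inP => e; rewrite inE.
- rewrite -subTset; apply/subsetP => x _; apply/bigcupP.
  by exists ([set x], set0); [apply: imset_f | rewrite inE].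
Qed.

Definition tc : nat := ex_minn tree_coverable_ex.

End TreeCover.

(* Imported only here: classical_sets shadows the finset notations used above. *)
From mathcomp Require Import all_classical all_reals all_analysis.
Import numFieldNormedType.Exports.

Section BinomialRandomGraph.
Variables (R : realType) (n : nat) (p : R).

Definition gnp_mass (G : sgraph 'I_n) : R :=
  \prod_(e in vpairs 'I_n) (if e \in edges G then p else 1 - p).

Definition gnp_prob (A : pred (sgraph 'I_n)) : R :=
  \sum_(G : sgraph 'I_n | A G) gnp_mass G.

End BinomialRandomGraph.

Definition gnp_aas (R : realType) (p : nat -> R)
    (A : forall n, pred (sgraph 'I_n)) : Prop :=
  (gnp_prob (p n) (A n) @[n --> \oo] --> (1 : R))%classic.

(* Main.v *)
(* Call a set X of vertices, together with a vertex y outside X, an obstruction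
   if X + y is independent and every other vertex has fewer than r neighbours in
   X.  Give the at most r - 1 edges from each outside vertex to X distinct colours
   among the first r - 1, and the last colour to every other edge.  The components
   of the first r - 1 colours that meet X are then stars centred in X, so no
   monochromatic connected subgraph contains two vertices of X + y, and the tree
   cover number exceeds |X|.

   Obstructions are found by the second moment method over a family of m-sets
   with pairwise intersections smaller than r: all r-sets for (i), pairwise
   disjoint m-sets for (ii).  For two sets of such a family, a vertex that is bad
   for both has at least r + 1 neighbours in their union, which happens with
   probability O(p^(r+1)) = o(1/n); hence the two events are asymptotically
   independent.  The expected number of obstructions is at least
   (1 - o(1)) |family| exp(- n C(m,r) p^r), which tends to infinity. *)
Require Import Defs.
From mathcomp Require Import all_boot all_order all_algebra.
From mathcomp Require Import zify ring lra.

Set Implicit Arguments.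
Unset Strict Implicit.
Unset Printing Implicit Defensive.

Import Order.TTheory GRing.Theory Num.Theory.

Local Open Scope ring_scope.

(** * Obstructions to small tree covers *)

Section Obstruction.
Variables (T : finType) (r : nat).
Implicit Types (F : {set {set T}}) (X : {set T}) (y v : T).

Definition nbrs F X v : {set T} := [set x in X | [set v; x] \in F].

(** [F] is an arbitrary family of sets rather than a graph, so that the event makes sense for a
    random subset of [{set T}]. *)
Definition obstruction y X F : bool :=
  [forall e in F, ~~ (e \subset y |: X)] &&
  [forall v in ~: (y |: X), (#|nbrs F X v| < r)%N].

End Obstruction.

Lemma obstruction_tc (T : finType) (r : nat) (G : sgraph T) (y : T)
    (X : {set T}) :
  (0 < r)%N -> y \notin X -> obstruction r y X (edges G) -> (#|X| < tc r G)%N.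
Proof.
case: r => // r _ yX /andP[/forall_inP indep /forall_inP few].
rewrite /tc; case: ex_minnP => s /forallP cov _.
(* After the case split, [r.+1] is the number of colours. Edges from an outside vertex to [X] are
   told apart by the position of their end in [X]; [ord_max] is the last colour. *)
pose c : {ffun {set T} -> 'I_r.+1} := [ffun e : {set T} =>
  if [pick x in e :&: X] is Some x then
    if [pick v in e :\: X] is Some v then
      inord (index x (enum (nbrs (edges G) X v))) else ord_max
  else ord_max].
have cE v x : v \notin X -> x \in X ->
    c [set v; x] = inord (index x (enum (nbrs (edges G) X v))).
  move=> vX xX; rewrite ffunE; case: pickP => [x'|/(_ x)]; last first.
    by rewrite !inE xX eqxx orbT.
  rewrite !inE => /andP[/orP[/eqP->|/eqP-> _]]; first by rewrite (negPf vX).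
  case: pickP => [v'|/(_ v)]; last by rewrite !inE eqxx vX.
  by rewrite !inE => /andP[v'X /orP[/eqP->//|/eqP vx]]; rewrite vx xX in v'X.
have cmax v x : v \notin X -> x \notin X -> c [set v; x] = ord_max.
  move=> vX xX; rewrite ffunE; case: pickP => // x'; rewrite !inE.
  by case/andP=> /orP[]/eqP->; rewrite ?(negPf vX) ?(negPf xX).
have /existsP[C /andP[Cs /andP[/forall_inP HC /eqP covC]]] := cov c.
apply: leq_trans Cs.
have Hex z : exists H, (H \in C) && (z \in H.1).
  have : z \in \bigcup_(H in C) H.1 by rewrite covC inE.
  by case/bigcupP=> H HinC zH; exists H; rewrite HinC.
(* [h z] is a member of the cover containing [z]; injectivity of [h] on [y |: X] forces more than
   [#|X|] members. *)
pose h z := xchoose (Hex z).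
have hC z : h z \in C by case/andP: (xchooseP (Hex z)).
have hz z : z \in (h z).1 by case/andP: (xchooseP (Hex z)).
suff hinj : {in y |: X &, injective h}.
  have <- : #|y |: X| = #|X|.+1 by rewrite cardsU1 yX.
  by rewrite -(card_in_imset hinj) subset_leq_card //; apply/subsetP => _ /imsetP[z _ ->].
have main z z' : z \in X -> z' \in y |: X -> h z = h z' -> z = z'.
  move=> zX z'X hzz'; apply/eqP; apply: contraT => zz'.
  have /and3P[/andP[sub _] /andP[_ conn] /existsP[i mono]] := HC _ (hC z).
  have {conn} : connect [rel u v | [set u; v] \in (h z).2] z z'.
    have := forall_inP conn _ (hz z) => /forall_inP/(_ z'); apply.
    by rewrite hzz' hz.
  have edgeG e : e \in (h z).2 -> e \in edges G by apply/subsetP.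
  (* [S] is [z] with its neighbours outside [y |: X]. Once [S] is closed under adjacency in [h z],
     it contains [z'], which forces [z' = z]. *)
  pose S := [pred u | (u == z) || ((u \notin y |: X) && ([set u; z] \in (h z).2))].
  have clos : closed [rel u v | [set u; v] \in (h z).2] S.
    apply: intro_closed => [|u v /= uv /orP[/eqP uz|/andP[uX uz]]].
    - by apply: sym_connect_sym => u v /=; rewrite setUC.
    - rewrite uz in uv; suff: (v == z) || (v \notin y |: X) && ([set v; z] \in (h z).2) by [].
      rewrite [[set v; z]]setUC uv andbT; apply/orP; right.
      apply/negP => vX; move: (indep _ (edgeG _ uv)).
      rewrite subUset !sub1set vX andbT => /negP; apply.
      by rewrite !inE zX orbT.
    (* At a leaf [u], the edge to [z] has an index below [r] as colour. Another edge to [v] in [X]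
       shares this index, so [v = z]; with [v] outside [X] its colour would be [ord_max]. *)
    - have uX' : u \notin X by move: uX; rewrite inE negb_or => /andP[].
      have := forall_inP mono _ uv; have := forall_inP mono _ uz.
      move=> /eqP<-; rewrite (cE _ _ uX' zX) => /eqP.
      have zN : z \in enum (nbrs (edges G) X u).
        by rewrite mem_enum inE zX edgeG.
      have sz : (size (enum (nbrs (edges G) X u)) <= r)%N.
        by rewrite -cardE -ltnS; apply: few; rewrite inE.
      have iz : (index z (enum (nbrs (edges G) X u)) < r)%N.
        by apply: leq_trans sz; rewrite index_mem.
      have [vX|vX] := boolP (v \in X).
        have vN : v \in enum (nbrs (edges G) X u).
          by rewrite mem_enum inE vX edgeG.
        rewrite (cE _ _ uX' vX) => /(congr1 val) /=.
        have iv : (index v (enum (nbrs (edges G) X u)) < r)%N.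
          by apply: leq_trans sz; rewrite index_mem.
        rewrite !inordK ?(ltn_trans iv) ?(ltn_trans iz) // => eqi.
        by rewrite inE /= -(nth_index z vN) eqi nth_index ?eqxx.
      rewrite (cmax _ _ uX' vX) => /(congr1 val) /=.
      by rewrite inordK ?(ltn_trans iz) // => ri; rewrite -ri ltnn in iz.
  move=> /(closed_connect clos) => zz.
  have : z' \in S by rewrite -zz inE /= eqxx.
  by rewrite inE /= eq_sym (negPf zz') z'X.
move=> z z' zX z'X hzz'.
have [zX'|zX'] := boolP (z \in X); first exact: main.
have [z'X'|z'X'] := boolP (z' \in X); first by apply/esym/main.
by move: zX z'X; rewrite !inE (negPf zX') (negPf z'X') !orbF => /eqP-> /eqP->.
Qed.

(** * Independence and second moments for random subsets *)

Section RandomSubset.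
Variables (R : realFieldType) (I : finType) (w : I -> R).
Implicit Types (f g : {set I} -> R) (S F : {set I}).

(** The law of a random subset containing each [e] independently with probability [w e]. *)
Definition wmass F : R := \prod_e (if e \in F then w e else 1 - w e).

Definition expect f : R := \sum_(F : {set I}) wmass F * f F.

Lemma sum_prod_set (u v : I -> R) :
  \sum_(F : {set I}) \prod_e (if e \in F then u e else v e) =
  \prod_e (u e + v e).
Proof. by rewrite bigA_distr; apply: eq_bigl => F; rewrite inE. Qed.

Definition determined S f := forall F, f (F :&: S) = f F.

Lemma eq_expect f g : f =1 g -> expect f = expect g.
Proof. by move=> fg; apply: eq_bigr => F _; rewrite fg. Qed.

Lemma expect_cst a : expect (fun=> a) = a.
Proof.
rewrite /expect -mulr_suml -[RHS]mul1r; congr (_ * _).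
by rewrite sum_prod_set big1 // => e _; rewrite addrC subrK.
Qed.

Lemma expectD f g : expect (fun F => f F + g F) = expect f + expect g.
Proof. by rewrite -big_split; apply: eq_bigr => F _; rewrite mulrDr. Qed.

Lemma expectZ a f : expect (fun F => a * f F) = a * expect f.
Proof. by rewrite mulr_sumr; apply: eq_bigr => F _; rewrite mulrCA. Qed.

Lemma expect_sum (J : finType) (P : pred J) (f : J -> {set I} -> R) :
  expect (fun F => \sum_(j | P j) f j F) = \sum_(j | P j) expect (f j).
Proof. by rewrite exchange_big; apply: eq_bigr => F _; rewrite mulr_sumr. Qed.

(* Exchanging the parts of two independent samples [F] and [F'] outside [S]
   preserves their joint law. *)
Lemma expectM S f g : determined S f -> determined (~: S) g ->
  expect (fun F => f F * g F) = expect f * expect g.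
Proof.
move=> fS gS; pose mix (F F' : {set I}) := (F :&: S) :|: (F' :&: ~: S).
pose sw (u : {set I} * {set I}) := (mix u.1 u.2, mix u.2 u.1).
have swK : involutive sw.
  move=> [F F']; rewrite /sw /mix /=; congr pair; apply/setP => e; rewrite !inE;
  by case: (e \in S) => /=; rewrite ?andbT ?andbF ?orbF ?orbT.
have massM F F' : wmass (mix F F') * wmass (mix F' F) = wmass F * wmass F'.
  rewrite -!big_split; apply: eq_bigr => e _; rewrite !inE.
  by case: (e \in S) => /=; rewrite ?andbT ?andbF ?orbF //= mulrC.
have mixf F F' : f (mix F F') = f F.
  rewrite -fS -(fS F); congr f; apply/setP => e; rewrite !inE.
  by case: (e \in S) => /=; rewrite ?andbT ?andbF ?orbF.
have mixg F F' : g (mix F F') = g F'.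
  rewrite -gS -(gS F'); congr g; apply/setP => e; rewrite !inE.
  by case: (e \in S) => /=; rewrite ?andbT ?andbF ?orbF.
rewrite [RHS]mulr_suml; under [RHS]eq_bigr do rewrite mulr_sumr.
rewrite pair_big /= (reindex_inj (inv_inj swK)) /=.
rewrite -[LHS]mulr1 -(expect_cst 1) [LHS]mulr_suml.
under [LHS]eq_bigr do rewrite mulr_sumr.
rewrite pair_big /=; apply: eq_bigr => [[F F']] _ /=.
rewrite mixf mixg [RHS]mulrACA massM; ring.
Qed.

Lemma determinedW S S' f : S \subset S' -> determined S f -> determined S' f.
Proof. by move=> SS' fS F; rewrite -fS -setIA (setIidPr SS') fS. Qed.

(** Induction on [#|A|]: the product of the remaining factors depends only on coordinates outside
    [S x], so [expectM] splits off one factor. *)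
Lemma expect_prod (J : finType) (A : {set J}) (S : J -> {set I})
    (f : J -> {set I} -> R) :
  {in A &, forall i j, i != j -> [disjoint S i & S j]} ->
  {in A, forall j, determined (S j) (f j)} ->
  expect (fun F => \prod_(j in A) f j F) = \prod_(j in A) expect (f j).
Proof.
elim: {A}#|A| {-2}A (erefl #|A|) => [|n IH] A cardA disj det.
  move/eqP: cardA; rewrite cards_eq0 => /eqP->.
  rewrite big_set0 -[RHS](expect_cst 1).
  by apply: eq_expect => F; rewrite big_set0.
have /set0Pn[x xA'] : A != set0 by rewrite -card_gt0 cardA.
move: cardA disj det; rewrite -(setD1K xA').
have : x \notin A :\ x by rewrite !inE eqxx.
move: (A :\ x) => {xA'}{}A xA.
rewrite cardsU1 xA => -[cardA] disj det.
rewrite big_setU1 //= -IH //; first last.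
- by move=> j jA; apply: det; rewrite setU1r.
- by move=> i j iA jA; apply: disj; rewrite setU1r.
rewrite -(expectM (S := S x)); first last.
- move=> F; apply: eq_bigr => j jA; apply: (determinedW (S := S j)).
    rewrite -disjoints_subset; apply: disj; rewrite ?setU11 ?setU1r //.
    by apply: contraNneq xA => <-.
  by apply: det; rewrite setU1r.
- by apply: det; rewrite setU11.
by apply: eq_expect => F; rewrite big_setU1.
Qed.

Hypothesis w01 : forall e, 0 <= w e <= 1.

Lemma wmass_ge0 F : 0 <= wmass F.
Proof.
by apply: prodr_ge0 => e _; have /andP[] := w01 e; case: ifP => _; lra.
Qed.

Lemma le_expect f g : (forall F, f F <= g F) -> expect f <= expect g.
Proof. by move=> fg; apply: ler_sum => F _; rewrite ler_wpM2l ?wmass_ge0. Qed.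

Lemma expect_mem e : expect (fun F => (e \in F)%:R) = w e.
Proof.
rewrite /expect (bigID (fun F => e \in F)) /= [X in _ + X]big1 => [|F]; last first.
  by move/negPf->; rewrite mulr0.
have disj F : e \in F ->
    wmass F = w e * \prod_(i | i != e) (if i \in F then w i else 1 - w i).
  by move=> eF; rewrite /wmass (bigD1 e) //= eF.
(* Replacing [w e] by 1 kills the sets that omit [e], so the sum over sets containing [e] becomes a
   full sum of total mass 1. *)
pose w' i := if i == e then 1 else w i.
rewrite addr0.
transitivity (w e * \sum_(F : {set I}) \prod_i (if i \in F then w' i else 1 - w' i)).
  rewrite [in RHS](bigID (fun F : {set I} => e \in F)) /=.
  rewrite [X in _ * (_ + X)]big1 ?addr0 => [|F eF]; last first.
    by rewrite (bigD1 e) //= (negPf eF) /w' eqxx subrr mul0r.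
  rewrite mulr_sumr; apply: eq_bigr => F eF; rewrite disj // eF mulr1.
  rewrite [in RHS](bigD1 e) //= eF {1}/w' eqxx mul1r; congr (_ * _).
  by apply: eq_bigr => i /negPf; rewrite /w' => ->.
by rewrite sum_prod_set big1 ?mulr1 // => i _; rewrite addrC subrK.
Qed.

Lemma expect_notin e : expect (fun F => (e \notin F)%:R) = 1 - w e.
Proof.
rewrite -[1 - w e](expect_cst (1 - w e)) -{1}expect_mem.
transitivity (expect (fun F => 1 + (-1) * (e \in F)%:R)).
  by apply: eq_expect => F; case: (e \in F) => /=; ring.
by rewrite expectD expectZ !expect_cst mulN1r.
Qed.

Lemma determined_mem e (h : bool -> R) : determined [set e] (fun F => h (e \in F)).
Proof. by move=> F; rewrite !inE eqxx andbT. Qed.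

Lemma expect_sub (A : {set I}) : expect (fun F => (A \subset F)%:R) = \prod_(e in A) w e.
Proof.
under [RHS]eq_bigr do rewrite -expect_mem.
rewrite -(expect_prod (S := fun e => [set e])).
- apply: eq_expect => F; case: (boolP (A \subset F)) => [/subsetP AF|].
    by rewrite big1 // => e /AF->.
  by case/subsetPn => e eA /negPf eF; rewrite (bigD1 e) //= eF mul0r.
- by move=> i j _ _ ij; rewrite disjoints1 inE.
- by move=> j _; apply: (determined_mem _ (fun b => b%:R)).
Qed.

Lemma expect_disjoint (A : {set I}) :
  expect (fun F => [disjoint A & F]%:R) = \prod_(e in A) (1 - w e).
Proof.
under [RHS]eq_bigr do rewrite -expect_notin.
rewrite -(expect_prod (S := fun e => [set e])).
- apply: eq_expect => F; case: (boolP [disjoint A & F]) => [AF|].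
    by rewrite big1 // => e /(disjointFr AF)->.
  rewrite -setI_eq0 => /set0Pn[e]; rewrite inE => /andP[eA eF].
  by rewrite (bigD1 e) //= eF mul0r.
- by move=> i j _ _ ij; rewrite disjoints1 inE.
- by move=> j _; apply: (determined_mem _ (fun b => (~~ b)%:R)).
Qed.

(* Second moment method, in the form [1_{N > 0} >= 2 (N / s) - (N / s)^2]
   with [s] the expectation of the number [N] of events that occur. *)
Lemma second_moment (J : finType) (A : {set J}) (B : J -> pred {set I}) (K : R) :
  0 <= K ->
  let P j := expect (fun F => (B j F)%:R) in
  0 < \sum_(j in A) P j ->
  {in A &, forall i j, i != j ->
    expect (fun F => (B i F && B j F)%:R) <= K * (P i * P j)} ->
  2 - K - (\sum_(j in A) P j)^-1 <=
  expect (fun F => [exists j in A, B j F]%:R).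
Proof.
move=> K0 P; set s := \sum_(j in A) P j => s0 pairs.
have P0 j : 0 <= P j.
  by rewrite -[0](expect_cst 0); apply: le_expect => F; rewrite ler0n.
pose N F : R := \sum_(j in A) (B j F)%:R.
have EN : expect N = s by rewrite expect_sum.
have EN2 : expect (fun F => N F ^+ 2) <= s + K * s ^+ 2.
  have -> : expect (fun F => N F ^+ 2) =
      \sum_(i in A) \sum_(j in A) expect (fun F => (B i F && B j F)%:R).
    under [RHS]eq_bigr do rewrite -expect_sum.
    rewrite -expect_sum; apply: eq_expect => F.
    rewrite expr2 mulr_suml; apply: eq_bigr => i _.
    by rewrite mulr_sumr; apply: eq_bigr => j _; rewrite -natrM mulnb.
  have -> : s + K * s ^+ 2 = \sum_(i in A) (P i + \sum_(j in A) K * (P i * P j)).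
    rewrite big_split /=; congr (_ + _); rewrite expr2 mulr_suml mulr_sumr.
    apply: eq_bigr => i _; rewrite mulr_sumr mulr_sumr.
    by apply: eq_bigr => j _.
  apply: ler_sum => i iA; rewrite (bigD1 i) //=; apply: lerD.
    by rewrite le_eqVlt; apply/orP; left; apply/eqP/eq_expect => F; rewrite andbb.
  rewrite [leRHS](bigD1 i) //= -[leLHS]add0r; apply: lerD.
    by rewrite !mulr_ge0.
  by apply: ler_sum => j /andP[jA ji]; apply: pairs; rewrite // eq_sym.
have step : 2 / s * s + - (s ^- 2) * expect (fun F => N F ^+ 2) <=
    expect (fun F => [exists j in A, B j F]%:R).
  rewrite -{2}EN -!expectZ -expectD; apply: le_expect => F.
  case: (boolP [exists j in A, B j F]) => [_|].
    have -> : 2 / s * N F + - (s ^- 2) * N F ^+ 2 = 1 - (1 - N F / s) ^+ 2.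
      by field; rewrite gt_eqF.
    by rewrite gerBl sqr_ge0.
  rewrite negb_exists_in => /forall_inP nB.
  rewrite /N big1 ?expr0n /= ?mulr0 ?addr0 // => j jA.
  by rewrite (negPf (nB j jA)).
apply: le_trans step; rewrite divfK ?gt_eqF //.
have -> : 2 - K - s^-1 = 2 - s ^- 2 * (s + K * s ^+ 2) by field; rewrite gt_eqF.
by rewrite mulNr lerD2l lerN2 ler_wpM2l // invr_ge0 exprn_ge0 // ltW.
Qed.

End RandomSubset.

(** * Probability of an obstruction *)

Section ObstructionProbability.
Variables (R : realFieldType) (T : finType) (p : R).
Hypothesis p01 : 0 <= p <= 1.
Implicit Types (F : {set {set T}}) (X Y : {set T}) (y v : T).

(** Weight 0 off the pairs makes the random subset of [{set T}] an edge set with probability 1. *)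
Definition pair_weight (e : {set T}) : R := if e \in vpairs T then p else 0.
Local Notation E := (expect pair_weight).

Lemma pair_weight01 e : 0 <= pair_weight e <= 1.
Proof. by rewrite /pair_weight; case: ifP => _; rewrite ?p01 ?lexx ?ler01. Qed.

Definition star v Y : {set {set T}} := [set [set v; x] | x in Y].

Lemma nbrs_star F Y v : nbrs (F :&: star v Y) Y v = nbrs F Y v.
Proof.
apply/setP => x; rewrite !inE; have [xY /=|//] := boolP (x \in Y).
by rewrite /star (imset_f (fun x => [set v; x])) ?andbT.
Qed.

Lemma determined_nbrs (h : {set T} -> R) Y v :
  determined (star v Y) (fun F => h (nbrs F Y v)).
Proof. by move=> F; rewrite nbrs_star. Qed.

Lemma star_disjoint Y v v' : v \notin Y -> v' \notin Y -> v != v' ->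
  [disjoint star v Y & star v' Y].
Proof.
move=> vY v'Y vv'; apply/pred0P => e /=; apply: contraTF vv'.
case/andP=> /imsetP[x xY ->] /imsetP[x' x'Y /setP/(_ v)].
rewrite !inE eqxx negbK /= => /esym/orP[//|/eqP vx'].
by rewrite vx' x'Y in vY.
Qed.

Lemma starS v Y Y' : Y \subset Y' -> star v Y \subset star v Y'.
Proof. exact: imsetS. Qed.

Lemma star_inj Y v : v \notin Y -> {in Y &, injective (fun x => [set v; x])}.
Proof.
move=> vY x x' xY x'Y /setP/(_ x); rewrite !inE eqxx orbT => /esym.
by case/orP => /eqP // xv; rewrite -xv xY in vY.
Qed.

(** Union bound over the [k]-subsets of [Y]: each is joined completely to [v] with probability
    [p ^+ k]. *)
Lemma many_nbrs Y v k : v \notin Y ->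
  E (fun F => (k <= #|nbrs F Y v|)%N%:R) <= 'C(#|Y|, k)%:R * p ^+ k.
Proof.
move=> vY.
pose D := [set S : {set T} | S \subset Y & #|S| == k].
have <- : E (fun F => \sum_(S in D) (star v S \subset F)%:R) =
          'C(#|Y|, k)%:R * p ^+ k.
  rewrite expect_sum -cards_draws -sum1_card natr_sum mulr_suml.
  apply: eq_bigr => S; rewrite !inE => /andP[SY /eqP <-].
  have inj : {in S &, injective (fun x => [set v; x])}.
    by apply: star_inj; apply: contraNN vY; apply/subsetP.
  rewrite expect_sub big_imset //= mul1r.
  rewrite -prodr_const; apply: eq_bigr => x xS.
  rewrite /pair_weight inE cards2 ifT //.
  by rewrite (contraNneq _ vY) // => ->; apply: (subsetP SY).
apply: le_expect => [|F]; first exact: pair_weight01.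
have [kN|_] := leqP k #|nbrs F Y v|; last by apply: sumr_ge0 => S _; rewrite ler0n.
have /card_gt0P[S] : (0 < #|[set S : {set T} | S \subset nbrs F Y v & #|S| == k]|)%N.
  by rewrite cards_draws bin_gt0.
rewrite inE => /andP[SN Sk].
have SY : S \subset Y by apply: subset_trans SN _; apply/subsetP => x; rewrite inE => /andP[].
rewrite (bigD1 S) /=; last by rewrite !inE SY.
rewrite [star v S \subset F](_ : _ = true).
  by rewrite lerDl; apply: sumr_ge0 => ? _; rewrite ler0n.
apply/subsetP => _ /imsetP[x xS ->].
by have := subsetP SN _ xS; rewrite inE => /andP[].
Qed.

Variables (r : nat) (y : T).

(** The probability that [v] is bad for [X], that is, violates the degree condition of an
    obstruction. *)
Definition hit X v : R := E (fun F => (r <= #|nbrs F X v|)%N%:R).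

Lemma hit_ge0 X v : 0 <= hit X v.
Proof.
rewrite -[0](expect_cst pair_weight 0).
by apply: le_expect => [|F]; [exact: pair_weight01 | rewrite ler0n].
Qed.

Lemma expect_few_nbrs X v : E (fun F => (#|nbrs F X v| < r)%N%:R) = 1 - hit X v.
Proof.
rewrite -[X in X - _](expect_cst pair_weight 1) /hit -mulN1r -expectZ -expectD.
by apply: eq_expect => F; rewrite ltnNge; case: leqP => _ /=;
  rewrite ?mulr0 ?mulr1 ?addr0 ?subrr.
Qed.

(** The sets inside [y |: X] and the stars from distinct outside vertices to [X] use disjoint
    coordinates, so the conditions are independent. *)
Lemma expect_obstruction X : E (fun F => (obstruction r y X F)%:R) =
  \prod_(e in powerset (y |: X)) (1 - pair_weight e) *
  \prod_(v in ~: (y |: X)) (1 - hit X v).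
Proof.
rewrite -expect_disjoint.
under [in RHS]eq_bigr do rewrite -expect_few_nbrs.
rewrite -(expect_prod pair_weight (S := fun v => star v X)); first last.
- by move=> v _; apply: (determined_nbrs (fun N => (#|N| < r)%N%:R)).
- move=> v v'; rewrite !inE !negb_or => /andP[_ vX] /andP[_ v'X].
  exact: star_disjoint.
rewrite -(expectM pair_weight (S := powerset (y |: X))); first last.
- move=> F; apply: eq_bigr => v; rewrite inE => vX.
  have nb := @determined_nbrs (fun N => (#|N| < r)%N%:R) X v.
  apply: (determinedW _ nb F).
  rewrite -disjoints_subset disjoint_sym; apply/pred0P => e /=.
  apply: contraNF vX => /andP[]; rewrite inE => /subsetP sub /imsetP[x _ ev].
  by apply: sub; rewrite ev !inE eqxx.
- by move=> F; congr (_%:R); rewrite -!setI_eq0 setIC -setIA setIid setIC.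
apply: eq_expect => F; rewrite /obstruction -mulnb natrM; congr (_%:R * _).
- congr nat_of_bool; apply/forall_inP/idP => [FX|/pred0P FX e eF].
    apply/pred0P => e /=; rewrite inE; apply/negP => /andP[eX eF].
    by move: (FX e eF); rewrite eX.
  by apply/negP => eX; move: (FX e); rewrite /= inE eX eF.
- case: (boolP [forall v in _, _]) => [/forall_inP few|].
    by rewrite big1 // => v /few ->.
  rewrite negb_forall_in => /exists_inP[v vX /negPf few].
  by rewrite (bigD1 v) //= few mul0r.
Qed.

(** Only the conditions at vertices outside both sets are kept; the stars of these vertices to
    [X :|: X'] are pairwise disjoint. *)
Lemma expect_obstruction_pair X X' :
  E (fun F => (obstruction r y X F && obstruction r y X' F)%:R) <=
  \prod_(v in ~: (y |: (X :|: X')))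
    E (fun F => ((#|nbrs F X v| < r) && (#|nbrs F X' v| < r))%N%:R).
Proof.
rewrite -(expect_prod pair_weight (S := fun v => star v (X :|: X'))); first last.
- move=> v _; have nb Y : Y \subset X :|: X' ->
    determined (star v (X :|: X')) (fun F => (#|nbrs F Y v| < r)%N%:R : R).
    move=> YX; have nb := @determined_nbrs (fun N => (#|N| < r)%N%:R) Y v.
    by apply: (determinedW _ nb); exact: starS.
  move=> F; rewrite -!mulnb !natrM; congr (_ * _).
    by apply: nb; rewrite subsetUl.
  by apply: nb; rewrite subsetUr.
- move=> v v'; rewrite !inE !negb_or => /andP[_ vX] /andP[_ v'X].
  by apply: star_disjoint; rewrite inE negb_or.
apply: le_expect => [|F]; first exact: pair_weight01.
case: andP => [[/andP[_ /forall_inP fX] /andP[_ /forall_inP fX']]|_]; last first.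
  by apply: prodr_ge0 => v _; rewrite ler0n.
rewrite big1 // => v; rewrite !inE !negb_or => /and3P[vy vX vX'].
by rewrite fX ?fX' // !inE negb_or vy.
Qed.

Variable m : nat.
(** [M] bounds the probability of being bad for one [m]-set, and [d] that of having more than [r]
    neighbours in a union of two. *)
Local Notation M := ('C(m, r)%:R * p ^+ r).
Local Notation d := ('C(m + m, r.+1)%:R * p ^+ r.+1).

Lemma hit_le X v : #|X| = m -> v \notin X -> hit X v <= M.
Proof. by move=> Xm; rewrite -Xm; apply: many_nbrs. Qed.

(* The neighbourhood of [v] in [X :|: X'] has at least [r + r - (r - 1)]
   elements when [v] is bad for both [X] and [X']. *)
Lemma expect_few_nbrs_pair X X' v :
  #|X| = m -> #|X'| = m -> (#|X :&: X'| < r)%N -> v \notin X :|: X' ->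
  E (fun F => ((#|nbrs F X v| < r) && (#|nbrs F X' v| < r))%N%:R) <=
  1 - hit X v - hit X' v + d.
Proof.
move=> Xm X'm XX' vXX'.
have dE : E (fun F => (r.+1 <= #|nbrs F (X :|: X') v|)%N%:R) <= d.
  apply: le_trans (many_nbrs _ vXX') _.
  rewrite ler_wpM2r ?exprn_ge0 //; first by case/andP: p01.
  by rewrite ler_nat leq_bin2l // -{1}Xm -X'm leq_card_setU.
(* What remains is inclusion-exclusion, checked pointwise. *)
apply: le_trans (lerD (lexx _) dE).
rewrite -[X in X - _ - _](expect_cst pair_weight 1) /hit.
rewrite -[- E (fun F => (r <= #|nbrs F X v|)%N%:R)]mulN1r.
rewrite -[- E (fun F => (r <= #|nbrs F X' v|)%N%:R)]mulN1r.
rewrite -!expectZ -!expectD.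
apply: le_expect => [|F]; first exact: pair_weight01.
case: (ltnP _ r) => [_|N1]; case: (ltnP _ r) => [_|N2] /=; try lra.
- by rewrite !(mulr0, mulr1, addr0) lerDl ler0n.
- by rewrite !(mulr0, mulr1, addr0, subrr, add0r) ler0n.
- by rewrite !(mulr0, mulr1, addr0, subrr, add0r) ler0n.
rewrite [(r < _)%N](_ : _ = true) /=; first lra.
have -> : nbrs F (X :|: X') v = nbrs F X v :|: nbrs F X' v.
  by apply/setP => x; rewrite !inE; case: (_ \in F); rewrite ?andbF ?andbT.
have := cardsUI (nbrs F X v) (nbrs F X' v).
have : (#|nbrs F X v :&: nbrs F X' v| <= #|X :&: X'|)%N.
  by apply: subset_leq_card; apply/subsetP => x; rewrite !inE => /andP[/andP[-> _] /andP[-> _]].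
by move: XX' N1 N2; lia.
Qed.

Hypothesis M2 : M <= 2^-1.

Let M_ge0 : 0 <= M.
Proof. by rewrite mulr_ge0 // exprn_ge0 //; case/andP: p01. Qed.
Let d_ge0 : 0 <= d.
Proof. by rewrite mulr_ge0 // exprn_ge0 //; case/andP: p01. Qed.

(** The pairs in [Y] are crudely counted by all its subsets; for [Y] of constant size the bound
    still tends to 1 as [p] tends to 0. *)
Lemma prod_pair_weight_ge Y :
  (1 - p) ^+ (2 ^ #|Y|) <= \prod_(e in powerset Y) (1 - pair_weight e).
Proof.
rewrite -card_powerset -prodr_const; apply: ler_prod => e _.
by move: p01; rewrite /pair_weight; case: ifP => _; lra.
Qed.

Lemma expect_obstruction_ge X : #|X| = m -> y \notin X ->
  (1 - p) ^+ (2 ^ m.+1) * (1 - M) ^+ #|T| <=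
  E (fun F => (obstruction r y X F)%:R).
Proof.
move=> Xm yX; rewrite expect_obstruction.
have p1 : 0 <= 1 - p by move: p01; lra.
have M1 : 0 <= 1 - M <= 1 by move: M2 M_ge0; lra.
apply: ler_pM; rewrite ?exprn_ge0 //; first by case/andP: M1.
  by have := prod_pair_weight_ge (y |: X); rewrite cardsU1 yX Xm add1n.
apply: (@le_trans _ _ ((1 - M) ^+ #|~: (y |: X)|)).
  rewrite ler_wiXn2l //; [by case/andP: M1 | by case/andP: M1 | exact: max_card].
rewrite -prodr_const; apply: ler_prod => v; rewrite !inE negb_or => /andP[_ vX].
by rewrite lerD2l lerN2 hit_le //; case/andP: M1 => ->.
Qed.

(** The right-hand product has extra factors only for vertices of [X']: at most [m] of them, each at
    least [1 - M]. *)
Lemma prod_hit_ge X X' : #|X| = m -> #|X'| = m ->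
  (1 - M) ^+ m * \prod_(v in ~: (y |: (X :|: X'))) (1 - hit X v) <=
  \prod_(v in ~: (y |: X)) (1 - hit X v).
Proof.
move=> Xm X'm.
have M1 : 0 <= 1 - M <= 1 by move: M2 M_ge0; lra.
have hit1 v : v \notin X -> 1 - M <= 1 - hit X v.
  by move=> vX; rewrite lerD2l lerN2 hit_le.
rewrite [leRHS](bigID (fun v => v \in X')) /=.
apply: ler_pM.
- by rewrite exprn_ge0 //; case/andP: M1.
- apply: prodr_ge0 => v; rewrite !inE !negb_or => /and3P[_ vX _].
  by have := hit1 v vX; case/andP: M1 => *; lra.
- pose B := X' :\: (y |: X).
  have -> : \prod_(i in ~: (y |: X) | i \in X') (1 - hit X i) =
            \prod_(i in B) (1 - hit X i).
    by apply: eq_bigl => v; rewrite !inE.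
  apply: (@le_trans _ _ ((1 - M) ^+ #|B|)).
    case/andP: M1 => ? ?; rewrite ler_wiXn2l // -X'm.
    by apply: subset_leq_card; exact: subsetDl.
  rewrite -prodr_const; apply: ler_prod => v; rewrite !inE negb_or => /andP[/andP[_ vX] _].
  by rewrite hit1 //; case/andP: M1 => ->.
- rewrite le_eqVlt; apply/orP; left; apply/eqP/eq_bigl => v.
  by rewrite !inE !negb_or andbA.
Qed.

(** Approximate independence. The squared factor pays for the conditions dropped inside the two
    sets, and [1 + 4 * d] at each vertex for being bad for both. *)
Lemma expect_obstruction_pair_le X X' :
  #|X| = m -> #|X'| = m -> (#|X :&: X'| < r)%N -> y \notin X -> y \notin X' ->
  ((1 - p) ^+ (2 ^ m.+1) * (1 - M) ^+ m) ^+ 2 *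
  E (fun F => (obstruction r y X F && obstruction r y X' F)%:R) <=
  (1 + 4 * d) ^+ #|T| * (E (fun F => (obstruction r y X F)%:R) *
                         E (fun F => (obstruction r y X' F)%:R)).
Proof.
move=> Xm X'm XX' yX yX'.
have p1 : 0 <= 1 - p by move: p01; lra.
have M1 : 0 <= 1 - M by move: M2; lra.
have half Y v : #|Y| = m -> v \notin Y -> 2^-1 <= 1 - hit Y v.
  by move=> Ym vY; have := hit_le Ym vY; move: M2; lra.
set Z := ~: (y |: (X :|: X')).
have step : E (fun F => (obstruction r y X F && obstruction r y X' F)%:R) <=
    (1 + 4 * d) ^+ #|T| *
    (\prod_(v in Z) (1 - hit X v) * \prod_(v in Z) (1 - hit X' v)).
  apply: le_trans (expect_obstruction_pair _ _) _.
  apply: (@le_trans _ _ ((1 + 4 * d) ^+ #|Z| *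
    (\prod_(v in Z) (1 - hit X v) * \prod_(v in Z) (1 - hit X' v)))); last first.
    rewrite ler_wpM2r //.
      rewrite mulr_ge0 //; apply: prodr_ge0 => v; rewrite !inE !negb_or => /and3P[_ vX vX'].
        by apply: le_trans (half _ _ Xm vX); lra.
      by apply: le_trans (half _ _ X'm vX'); lra.
    by rewrite ler_weXn2l ?max_card //; move: d_ge0; lra.
  rewrite -prodr_const -!big_split; apply: ler_prod => v.
  rewrite !inE !negb_or => /and3P[_ vX vX'].
  have h := half _ _ Xm vX; have h' := half _ _ X'm vX'.
  have h0 := hit_ge0 X v; have h0' := hit_ge0 X' v.
  rewrite -[X in X <= _ <= _](expect_cst pair_weight 0); apply/andP; split.
    by apply: le_expect => [|F]; [exact: pair_weight01 | rewrite ler0n].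
  apply: le_trans (expect_few_nbrs_pair Xm X'm XX' _) _.
    by rewrite inE negb_or vX.
  (* As both factors are at least 1/2, the additive error [d] is at most [4 * d] times their
     product; and 1 - s - t <= (1 - s)(1 - t) for s, t >= 0. *)
  have hh : 4^-1 <= (1 - hit X v) * (1 - hit X' v).
    by apply: le_trans (ler_pM _ _ h h'); lra.
  have : d <= 4 * d * ((1 - hit X v) * (1 - hit X' v)).
    rewrite mulrAC -[leLHS]mul1r ler_wpM2r //; lra.
  move=> /=; nra.
apply: le_trans (ler_wpM2l _ step) _.
  by rewrite exprn_ge0 // mulr_ge0 ?exprn_ge0.
rewrite mulrCA ler_wpM2l ?exprn_ge0 //; first by move: d_ge0; lra.
rewrite expr2 mulrACA !expect_obstruction.
have prod0 Y : Y = X \/ Y = X' -> 0 <= \prod_(v in Z) (1 - hit Y v).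
  move=> YX; apply: prodr_ge0 => v; rewrite !inE !negb_or => /and3P[_ vX vX'].
  by case: YX => ->; [have := half _ _ Xm vX | have := half _ _ X'm vX']; lra.
apply: ler_pM.
- by rewrite !mulr_ge0 ?exprn_ge0 ?prod0 //; left.
- by rewrite !mulr_ge0 ?exprn_ge0 ?prod0 //; right.
- rewrite -mulrA; apply: ler_pM; rewrite ?mulr_ge0 ?exprn_ge0 ?prod0 //; first by left.
    by have := prod_pair_weight_ge (y |: X); rewrite cardsU1 yX Xm add1n.
  exact: prod_hit_ge.
- rewrite -mulrA; apply: ler_pM; rewrite ?mulr_ge0 ?exprn_ge0 ?prod0 //; first by right.
    by have := prod_pair_weight_ge (y |: X'); rewrite cardsU1 yX' X'm add1n.
  by rewrite /Z [X :|: X']setUC; exact: prod_hit_ge.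
Qed.

End ObstructionProbability.

(** * Families of vertex sets with small pairwise intersections *)

(** Vertex 0 serves as [y] and block i is {i m + 1, ..., i m + m}; the strict inequality leaves room
    for vertex 0. *)
Lemma disjoint_blocks (m k n : nat) : (0 < m)%N -> (k * m < n)%N ->
  exists (y : 'I_n) (FF : {set {set 'I_n}}),
    [/\ #|FF| = k, {in FF, forall X : {set 'I_n}, #|X| = m /\ y \notin X} &
        {in FF &, forall X X' : {set 'I_n}, X != X' -> X :&: X' = set0}].
Proof.
case: n => // n m0; rewrite ltnS => kmn.
pose pos (i : 'I_k) (j : 'I_m) : 'I_n.+1 := inord (i * m + j).+1.
have posE i j : pos i j = (i * m + j).+1 :> nat.
  rewrite inordK // ltnS; apply: leq_trans kmn.
  apply: (@leq_trans (i * m + m)); first by rewrite ltn_add2l.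
  by rewrite addnC -mulSn leq_mul2r ltn_ord orbT.
have pos_inj i j i' j' : pos i j = pos i' j' -> i = i' /\ j = j'.
  move=> /(congr1 (@nat_of_ord _)); rewrite !posE => -[eq].
  have ii' : i = i' :> nat.
    by have := congr1 (divn^~ m) eq; rewrite !divnMDl // !divn_small ?addn0.
  by split; apply: val_inj => //=; move: eq; rewrite ii' => /addnI.
pose B i := [set pos i j | j : 'I_m].
have Binj : injective B.
  move=> i i' /setP/(_ (pos i (Ordinal m0))); rewrite imset_f //.
  by move/esym/imsetP => [j _ /pos_inj[]].
exists ord0, [set B i | i : 'I_k]; split.
- by rewrite card_imset // card_ord.
- move=> _ /imsetP[i _ ->]; split.
    by rewrite card_imset ?card_ord // => j j' /pos_inj[].
  by apply/imsetP => -[j _ /(congr1 (@nat_of_ord _))]; rewrite posE.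
- move=> _ _ /imsetP[i _ ->] /imsetP[i' _ ->] BB'.
  apply/setP => v; rewrite !inE; apply: contraNF BB'.
  by case/andP=> /imsetP[j _ ->] /imsetP[j' _ /pos_inj[-> _]].
Qed.

Lemma expn_le_ffact n k : ((n - k) ^ k <= n ^_ k)%N.
Proof.
elim: k => [|k IH] //; rewrite expnSr ffactnSr; apply: leq_mul.
  case: (posnP k) => [->//|k0].
  by apply: leq_trans IH; rewrite leq_exp2r // leq_sub2l.
by rewrite leq_sub2l.
Qed.

(** Take all [r]-sets avoiding vertex 0, which serves as [y]; distinct [r]-sets cannot share [r]
    points. *)
Lemma all_subsets_family (r n : nat) : (0 < n)%N ->
  exists (y : 'I_n) (FF : {set {set 'I_n}}),
    [/\ ((n.-1 - r) ^ r <= #|FF| * r`!)%N,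
        {in FF, forall X : {set 'I_n}, #|X| = r /\ y \notin X} &
        {in FF &, forall X X' : {set 'I_n}, X != X' -> (#|X :&: X'| < r)%N}].
Proof.
case: n => // n _.
exists ord0, [set X : {set 'I_n.+1} | X \subset ~: [set ord0] & #|X| == r].
split.
- by rewrite cards_draws cardsC1 card_ord bin_ffact expn_le_ffact.
- move=> X; rewrite inE => /andP[/subsetP X0 /eqP->]; split=> //.
  by apply/negP => /X0; rewrite !inE eqxx.
- move=> X X'; rewrite !inE => /andP[_ /eqP Xr] /andP[_ /eqP X'r].
  apply: contraNT; rewrite -leqNgt => le.
  have XX' : X \subset X'.
    have : X :&: X' == X by rewrite eqEcard subsetIl Xr.
    by move/eqP/setIidPl.
  by rewrite eqEcard XX' Xr X'r /=.
Qed.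

(* Imported only here: classical_sets shadows the finset notations used above. *)
From mathcomp Require Import all_classical all_reals all_analysis.
Import numFieldNormedType.Exports.
Local Open Scope classical_set_scope.
Local Open Scope ring_scope.

(** * Transfer from random subsets to the random graph *)

Section Gnp.
Variables (R : realType) (n : nat) (p : R).
Hypothesis p01 : 0 <= p <= 1.

Lemma gnp_mass_ge0 (G : sgraph 'I_n) : 0 <= gnp_mass p G.
Proof.
by apply: prodr_ge0 => e _; move: p01; case: ifP => _; lra.
Qed.

(** Families containing a non-pair have mass 0; the others are exactly the edge sets of graphs, and
    there each non-pair contributes a factor 1. *)
Lemma expect_gnp (f : {set {set 'I_n}} -> R) :
  expect (pair_weight p) f = \sum_(G : sgraph 'I_n) gnp_mass p G * f (edges G).
Proof.
rewrite /expect (bigID (fun F : {set {set 'I_n}} => F \subset vpairs 'I_n)) /=.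
rewrite [X in _ + X]big1 ?addr0.
  rewrite (reindex_omap (@edges _) insub) /=; last first.
    by move=> F FV; rewrite insubT.
  apply: eq_big => [G|G _].
    by rewrite edges_sub /= (valK G) eqxx.
  congr (_ * _); rewrite /gnp_mass /wmass [RHS]big_mkcond.
  apply: eq_bigr => e _; rewrite /pair_weight; have [//|eV] := boolP (e \in vpairs _).
  by rewrite ifN ?subr0 //; apply: contraNN eV; apply/fintype.subsetP/edges_sub.
move=> F /fintype.subsetPn[e eF /negPf eV].
by rewrite /wmass (bigD1 e) //= eF /pair_weight eV mul0r mul0r.
Qed.

Lemma gnp_prob_le1 (A : pred (sgraph 'I_n)) : gnp_prob p A <= 1.
Proof.
have <- : \sum_(G : sgraph 'I_n) gnp_mass p G = 1.
  rewrite -[RHS](expect_cst (@pair_weight _ 'I_n p) 1) expect_gnp.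
  by apply: eq_bigr => G _; rewrite mulr1.
rewrite /gnp_prob [leRHS](bigID A) /= lerDl.
by apply: sumr_ge0 => G _; exact: gnp_mass_ge0.
Qed.

Lemma gnp_prob_mono (A B : pred (sgraph 'I_n)) :
  (forall G, A G -> B G) -> gnp_prob p A <= gnp_prob p B.
Proof.
move=> AB; rewrite /gnp_prob big_mkcond [leRHS]big_mkcond.
apply: ler_sum => G _; have := AB G; case: (A G) => [->//|_].
by case: ifP => // _; exact: gnp_mass_ge0.
Qed.

Lemma expect_le_gnp_prob (B : pred {set {set 'I_n}}) (A : pred (sgraph 'I_n)) :
  (forall G, B (edges G) -> A G) ->
  expect (pair_weight p) (fun F => (B F)%:R) <= gnp_prob p A.
Proof.
move=> BA; rewrite expect_gnp /gnp_prob [leRHS]big_mkcond.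
apply: ler_sum => G _; have := BA G; case: (B _) => [->//|_].
  by rewrite mulr1.
by rewrite mulr0; case: ifP => // _; exact: gnp_mass_ge0.
Qed.

(** [second_moment] with [K] taken from [expect_obstruction_pair_le] and the expected number bounded
    below by [expect_obstruction_ge]. *)
Lemma gnp_tc_ge (r m : nat) (y : 'I_n) (FF : {set {set 'I_n}}) :
  (0 < r)%N -> p < 1 -> (0 < #|FF|)%N -> 'C(m, r)%:R * p ^+ r <= 2^-1 ->
  {in FF, forall X : {set 'I_n}, #|X| = m /\ y \notin X} ->
  {in FF &, forall X X' : {set 'I_n}, X != X' -> (#|X :&: X'| < r)%N} ->
  2 - (1 + 4 * ('C(m + m, r.+1)%:R * p ^+ r.+1)) ^+ n /
      ((1 - p) ^+ (2 ^ m.+1) * (1 - 'C(m, r)%:R * p ^+ r) ^+ m) ^+ 2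
    - (#|FF|%:R * ((1 - p) ^+ (2 ^ m.+1) * (1 - 'C(m, r)%:R * p ^+ r) ^+ n))^-1
  <= gnp_prob p (fun G : sgraph 'I_n => (m < tc r G)%N).
Proof.
move=> r0 p1 FF0 M2 FFm FFr.
set d := 'C(m + m, r.+1)%:R * _; set M := 'C(m, r)%:R * _ in M2 *.
have d0 : 0 <= d by rewrite mulr_ge0 // exprn_ge0 //; case/andP: p01.
have p0 : 0 < 1 - p by move: p1; lra.
have M0 : 0 < 1 - M by move: M2; lra.
set a := (1 - p) ^+ _; have a0 : 0 < a by rewrite exprn_gt0.
set K := (1 + 4 * d) ^+ n / _.
have K0 : 0 <= K.
  by rewrite divr_ge0 // ?exprn_ge0 ?mulr_ge0 ?ltW ?exprn_gt0 //; move: d0; lra.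
pose P X := expect (pair_weight p) (fun F => (obstruction r y X F)%:R).
have s_ge : #|FF|%:R * (a * (1 - M) ^+ n) <= \sum_(X in FF) P X.
  rewrite -sumr_const mulr_suml; apply: ler_sum => X /FFm[Xm yX].
  by rewrite mul1r -[n in _ ^+ n]card_ord; apply: expect_obstruction_ge.
have b0 : 0 < #|FF|%:R * (a * (1 - M) ^+ n).
  by rewrite !mulr_gt0 ?exprn_gt0 ?ltr0n.
have s0 := lt_le_trans b0 s_ge.
apply: (@le_trans _ _ (2 - K - (\sum_(X in FF) P X)^-1)).
  by rewrite lerD2l lerN2 lef_pV2 ?posrE.
apply: (@le_trans _ _ (expect (pair_weight p)
   (fun F => [exists X in FF, obstruction r y X F]%:R))).
  apply: second_moment => //; first exact: pair_weight01.
  move=> X X' XF X'F XX'; have [Xm yX] := FFm _ XF; have [X'm yX'] := FFm _ X'F.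
  rewrite /K mulrAC ler_pdivlMr ?exprn_gt0 ?mulr_gt0 ?exprn_gt0 //.
  have := expect_obstruction_pair_le p01 M2 Xm X'm (FFr _ _ XF X'F XX') yX yX'.
  by rewrite card_ord [leRHS]mulrC [X in X <= _]mulrC [leRHS]mulrC.
apply: expect_le_gnp_prob => G /exists_inP[X XF obs].
by have [<- yX] := FFm _ XF; exact: obstruction_tc obs.
Qed.

End Gnp.

(** * Asymptotics *)

(** Use e^t >= 1 + t at t = x + 2x^2, together with (1 - x)(1 + t) = 1 + x^2 (1 - 2x) >= 1. *)
Lemma expR_le_1B (R : realType) (x : R) : 0 <= x <= 2^-1 ->
  expR (- (x + 2 * x ^+ 2)) <= 1 - x.
Proof.
move=> /andP[x0 x2]; rewrite expRN; have := expR_ge1Dx (x + 2 * x ^+ 2).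
have x20 := sqr_ge0 x.
move=> le; have e0 : 0 < 1 + (x + 2 * x ^+ 2) by lra.
apply: (@le_trans _ _ (1 + (x + 2 * x ^+ 2))^-1).
  by rewrite lef_pV2 ?posrE ?expR_gt0.
rewrite -[leLHS]mul1r ler_pdivrMr //.
have -> : (1 - x) * (1 + (x + 2 * x ^+ 2)) = 1 + x ^+ 2 * (1 - 2 * x) by ring.
by rewrite lerDl mulr_ge0 //; lra.
Qed.

Section Limits.
Variable R : realType.
Implicit Types u p : nat -> R.

Lemma cvg_exprn_seq u (l : R) k : u n @[n --> \oo] --> l ->
  u n ^+ k @[n --> \oo] --> l ^+ k.
Proof. by move=> ul; exact: cvg_comp ul (@exprn_continuous R k l). Qed.

Lemma cvg_expR_seq u (l : R) : u n @[n --> \oo] --> l ->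
  expR (u n) @[n --> \oo] --> expR l.
Proof. by move=> ul; exact: cvg_comp ul (@continuous_expR R l). Qed.

Lemma gt0_cvgMry_seq (c : R) u : 0 < c -> u n @[n --> \oo] --> +oo ->
  c * u n @[n --> \oo] --> +oo.
Proof. by move=> c0 uoo; apply: (cvg_comp _ _ uoo (gt0_cvgMry c0 cvg_id)). Qed.

Lemma exprn_cvg0 u k : (0 < k)%N -> (forall n, 0 <= u n) ->
  u n ^+ k @[n --> \oo] --> (0 : R) -> u n @[n --> \oo] --> (0 : R).
Proof.
move=> k0 u0 /cvgr0Pnorm_lt uk; apply/cvgr0Pnorm_lt => e e0.
have ek : 0 < e ^+ k by rewrite exprn_gt0.
near=> n; have : `|u n ^+ k| < e ^+ k by near: n; exact: uk.
rewrite !ger0_norm ?exprn_ge0 //; rewrite ltr_pXn2r ?nnegrE ?u0 ?ltW //.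
Unshelve. all: by end_near. Qed.

Lemma cvg_ln_nat : ln (n%:R : R) @[n --> \oo] --> +oo.
Proof.
apply/cvgryPge => A; near=> n.
have n0 : (0 < n)%N by near: n; exact: nbhs_infty_gt.
rewrite -[A]expRK ler_ln ?posrE ?expR_gt0 ?ltr0n //.
by near: n; exact: nbhs_infty_ger.
Unshelve. all: by end_near. Qed.

(** With x = ln n > 0, the exponential series gives n = e^x > x^(k+1)/(k+1)!, so the quotient is at
    most (k+1)!/ln n. *)
Lemma ln_exprn_div_cvg0 k :
  ln (n%:R : R) ^+ k / n%:R @[n --> \oo] --> (0 : R).
Proof.
have ln_gt : \forall n \near \oo, 0 < ln (n%:R : R).
  exact: (cvgryPgt _).1 cvg_ln_nat 0.
apply: (@squeeze_cvgr _ _ _ _ (fun=> 0) (fun n => k.+1`!%:R * (ln (n%:R : R))^-1)).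
- near=> n.
  have l0 : 0 < ln (n%:R : R) by near: n.
  have n0 : 0 < n%:R :> R.
    by rewrite ltr0n; near: n; exact: nbhs_infty_gt.
  apply/andP; split; first by rewrite divr_ge0 ?exprn_ge0 // ltW.
  apply: ltW => /=.
  rewrite ltr_pdivrMr // mulrAC ltr_pdivlMr // -exprSr.
  have := expR_ge1Dxn k (ltW l0); rewrite lnK ?posrE //.
  have f0 : 0 < k.+1`!%:R :> R by rewrite ltr0n fact_gt0.
  move=> le; rewrite mulrC -ltr_pdivrMr //; lra.
- exact: cvg_cst.
- rewrite -[X in _ --> X](mulr0 k.+1`!%:R); apply: cvgM; first exact: cvg_cst.
  by apply/gtr0_cvgV0 => //; exact: cvg_ln_nat.
Unshelve. all: by end_near. Qed.

(** Both limits are taken for r-th powers: (n p^(r+1))^r = n^r (p^r)^(r+1) is at most r^(r+1) (ln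
    n)^(r+1) / n. *)
Lemma near_threshold r p : (0 < r)%N -> (forall n, 0 <= p n) ->
  (\forall n \near \oo, p n ^+ r <= r%:R * ln (n%:R : R) / n%:R) ->
  p n @[n --> \oo] --> (0 : R) /\
  n%:R * p n ^+ r.+1 @[n --> \oo] --> (0 : R).
Proof.
move=> r0 p0 pr; split; apply: (@exprn_cvg0 _ r) => //.
- apply: (@squeeze_cvgr _ _ _ _ (fun=> 0) (fun n => r%:R * (ln (n%:R : R) ^+ 1 / n%:R))).
  + near=> n; rewrite exprn_ge0 //= expr1 mulrA; near: n; exact: pr.
  + exact: cvg_cst.
  + rewrite -[X in _ --> X](mulr0 r%:R); apply: cvgM; first exact: cvg_cst.
    exact: ln_exprn_div_cvg0.
- by move=> n; rewrite mulr_ge0 ?exprn_ge0.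
- apply: (@squeeze_cvgr _ _ _ _ (fun=> 0)
    (fun n => r%:R ^+ r.+1 * (ln (n%:R : R) ^+ r.+1 / n%:R))).
  + near=> n; rewrite exprn_ge0 ?mulr_ge0 ?exprn_ge0 //=.
    have n0 : 0 < n%:R :> R.
      by rewrite ltr0n; near: n; exact: nbhs_infty_gt.
    rewrite exprMn exprAC.
    apply: (@le_trans _ _ (n%:R ^+ r * (r%:R * ln (n%:R : R) / n%:R) ^+ r.+1)).
      rewrite ler_wpM2l ?exprn_ge0 ?(ltW n0) // lerXn2r ?nnegrE ?exprn_ge0 //; last first.
        by near: n; exact: pr.
      apply: le_trans (_ : p n ^+ r <= _); first by rewrite exprn_ge0.
      by near: n; exact: pr.
    rewrite !exprMn exprVn [n%:R ^+ r.+1]exprSr le_eqVlt; apply/orP; left.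
    by apply/eqP; field; rewrite gt_eqF //= expf_neq0 ?gt_eqF.
  + exact: cvg_cst.
  + rewrite -[X in _ --> X](mulr0 (r%:R ^+ r.+1)); apply: cvgM; first exact: cvg_cst.
    exact: ln_exprn_div_cvg0.
Unshelve. all: by end_near. Qed.

(** [k] bounds the family size from below, and the sequence assumed to diverge is the main term of
    the expected number of obstructions. *)
Lemma gnp_tc_aas (r m : nat) p (k : nat -> R) :
  (0 < r)%N -> (forall n, 0 <= p n <= 1) ->
  p n @[n --> \oo] --> (0 : R) ->
  n%:R * p n ^+ r.+1 @[n --> \oo] --> (0 : R) ->
  (\forall n \near \oo, exists (y : 'I_n) (FF : {set {set 'I_n}}),
    [/\ k n <= #|FF|%:R,
        {in FF, forall X : {set 'I_n}, #|X| = m /\ y \notin X} &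
        {in FF &, forall X X' : {set 'I_n}, X != X' -> (#|X :&: X'|%SET < r)%N}]) ->
  k n * expR (- (n%:R * ('C(m, r)%:R * p n ^+ r))) @[n --> \oo] --> +oo ->
  gnp_aas p (fun n G => (m < tc r G)%N).
Proof.
move=> r0 p01 p_0 q_0 fam koo.
have p0 n : 0 <= p n by case/andP: (p01 n).
pose C : R := 'C(m, r)%:R; pose D : R := 'C(m + m, r.+1)%:R.
pose M n := C * p n ^+ r; pose q n := n%:R * p n ^+ r.+1.
pose a n := (1 - p n) ^+ (2 ^ m.+1).
pose g n := k n * expR (- (n%:R * M n)).
(* [g n * h n] is a lower bound for the expected number; [h] collects the cost of independence and
   the second-order part of (1 - M)^n. *)
pose h n := a n * expR (- (2 * C ^+ 2 * q n)).
have M_0 : M n @[n --> \oo] --> (0 : R).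
  rewrite -[X in _ --> X](mulr0 C); apply: cvgM; first exact: cvg_cst.
  by have := @cvg_exprn_seq p 0 r p_0; rewrite expr0n gtn_eqF.
have a_1 : a n @[n --> \oo] --> (1 : R).
  rewrite -[X in _ --> X](expr1n _ (2 ^ m.+1)); apply: cvg_exprn_seq.
  by rewrite -[X in _ --> X]subr0; apply: cvgB => //; exact: cvg_cst.
have h_1 : h n @[n --> \oo] --> (1 : R).
  rewrite -[X in _ --> X]mulr1; apply: cvgM => //.
  rewrite -[X in _ --> X]expR0; apply: cvg_expR_seq; rewrite -[X in _ --> X]oppr0.
  apply: cvgN; rewrite -[X in _ --> X](mulr0 (2 * C ^+ 2)).
  by apply: cvgM => //; exact: cvg_cst.
have g_gt0 : \forall n \near \oo, 0 < g n by exact: (cvgryPgt _).1 koo 0.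
(* The bound of [gnp_tc_ge] with (1 + 4d)^n replaced by e^(4nd); its limit is 2 - 1 - 0. *)
pose f n := 2 - expR (4 * D * q n) / (a n * (1 - M n) ^+ m) ^+ 2 - (g n)^-1 * (h n)^-1.
apply: (@squeeze_cvgr _ _ _ _ f (fun=> 1)); last exact: cvg_cst.
- near=> n; rewrite gnp_prob_le1 // andbT.
  have p1 : p n < 1 by near: n; exact: (cvgr_lt _ p_0).
  have M2 : M n <= 2^-1 by near: n; exact: (cvgr_le _ M_0).
  have M0 : 0 <= M n by rewrite mulr_ge0 ?exprn_ge0.
  have g0 : 0 < g n by near: n.
  have a0 : 0 < a n by rewrite exprn_gt0 // subr_gt0.
  have h0 : 0 < h n by rewrite mulr_gt0 ?expR_gt0.
  have [y [FF [kFF FFm FFr]]] : exists (y : 'I_n) (FF : {set {set 'I_n}}),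
    [/\ k n <= #|FF|%:R,
        {in FF, forall X : {set 'I_n}, #|X| = m /\ y \notin X} &
        {in FF &, forall X X' : {set 'I_n}, X != X' -> (#|X :&: X'|%SET < r)%N}].
    by near: n; exact: fam.
  have k0 : 0 < k n by move: g0; rewrite pmulr_lgt0 ?expR_gt0.
  have FF0 : (0 < #|FF|)%N by rewrite -(ltr0n R); exact: lt_le_trans kFF.
  apply: le_trans (gnp_tc_ge (p01 n) r0 p1 FF0 M2 FFm FFr).
  rewrite -/C -/D -/(M n) -/(a n); apply: lerB.
    rewrite lerD2l lerN2 ler_wpM2r //.
      by rewrite invr_ge0 exprn_ge0 // mulr_ge0 ?exprn_ge0 ?(ltW a0) //; lra.
    have -> : 4 * D * q n = n%:R * (4 * (D * p n ^+ r.+1)) by rewrite /q; ring.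
    rewrite expRM_natl lerXn2r ?nnegrE ?expR_ge0 //; last exact: expR_ge1Dx.
    by rewrite addr_ge0 ?mulr_ge0 ?exprn_ge0.
  have gh0 : 0 < g n * h n by apply: mulr_gt0.
  have b0 : 0 < #|FF|%:R * (a n * (1 - M n) ^+ n).
    rewrite mulr_gt0 ?ltr0n // mulr_gt0 ?a0 // exprn_gt0 //.
    by move: M2; lra.
  rewrite -invfM lef_pV2 ?posrE //.
  rewrite /g -[k n * _ * h n]mulrA /h; apply: ler_pM => //; first exact: ltW.
    by apply: mulr_ge0; [exact: expR_ge0|rewrite mulr_ge0 ?expR_ge0 // (ltW a0)].
  rewrite mulrCA ler_wpM2l ?(ltW a0) // -expRD.
  apply: (@le_trans _ _ (expR (n%:R * - (M n + 2 * M n ^+ 2)))); last first.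
    rewrite expRM_natl; apply: lerXn2r; rewrite ?nnegrE ?expR_ge0 ?expR_le_1B ?M0 ?M2 //.
    by move: M2; lra.
  rewrite ler_expR -opprD mulrN lerN2 mulrDr lerD2l.
  (* The second-order term is absorbed because p^(2r) <= p^(r+1), as p <= 1 and r >= 1. *)
  have -> : n%:R * (2 * M n ^+ 2) = 2 * C ^+ 2 * (n%:R * (p n ^+ r * p n ^+ r)).
    by rewrite /M; ring.
  rewrite ler_wpM2l ?mulr_ge0 ?sqr_ge0 // ler_wpM2l // exprSr.
  rewrite ler_wpM2l ?exprn_ge0 //.
  by rewrite -[leRHS]expr1 ler_wiXn2l //; case/andP: (p01 n).
- have -> : 1 = 2 - 1 / (1 * (1 - 0) ^+ m) ^+ 2 - 0 * 1^-1 :> R.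
    by rewrite mul0r !subr0 expr1n mulr1 expr1n divr1; ring.
  apply: cvgB; last first.
    apply: cvgM; last by apply: cvgV.
    by apply/gtr0_cvgV0.
  apply: cvgB; first exact: cvg_cst.
  apply: cvgM.
    rewrite -[X in _ --> X]expR0; apply: cvg_expR_seq.
    rewrite -[X in _ --> X](mulr0 (4 * D)).
    by apply: cvgM => //; exact: cvg_cst.
  apply: cvgV; first by rewrite mul1r subr0 !expr1n oner_eq0.
  apply: cvg_exprn_seq; apply: cvgM => //; apply: cvg_exprn_seq.
  by apply: cvgB => //; exact: cvg_cst.
Unshelve. all: by end_near. Qed.

End Limits.

(** * The two regimes of [p] *)

Lemma gnp_aas_mono (R : realType) (p : nat -> R)
    (A B : forall n, pred (sgraph 'I_n)) :
  (forall n, 0 <= p n <= 1) -> (forall n G, A n G -> B n G) ->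
  gnp_aas p A -> gnp_aas p B.
Proof.
move=> p01 AB aasA; apply: (@squeeze_cvgr _ _ _ _ (fun n => gnp_prob (p n) (A n))
  (fun=> 1)); last 2 first.
- exact: aasA.
- exact: cvg_cst.
near=> n; apply/andP; split; last exact: gnp_prob_le1.
by apply: gnp_prob_mono => // G; exact: AB.
Unshelve. all: by end_near. Qed.

Lemma powR_invn_exprn (R : realType) (x : R) (r : nat) : (0 < r)%N -> 0 <= x ->
  (x `^ r%:R^-1) ^+ r = x.
Proof.
move=> r0 x0; rewrite -powR_mulrn ?powR_ge0 // -powRrM mulVf ?powRr1 //.
by rewrite pnatr_eq0 -lt0n.
Qed.

(** Here m = r and e^(-n p^r) = n^(-r) e^w. For n >= 2(r + 1) one has n - 1 - r >= n/2, so the main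
    term is at least a constant times e^w. *)
Lemma tc_gt_r_aas (R : realType) (r : nat) (p w : nat -> R) :
  (0 < r)%N -> (forall n, 0 <= p n <= 1) -> w n @[n --> \oo] --> +oo ->
  (\forall n \near \oo, p n ^+ r = (r%:R * ln (n%:R : R) - w n) / n%:R) ->
  gnp_aas p (fun n G => (r < tc r G)%N).
Proof.
move=> r0 p01 woo pE.
have w_ge0 : \forall n \near \oo, 0 <= w n by exact: (cvgryPge _).1 woo 0.
have [||p_0 q_0] := @near_threshold R r p r0.
- by move=> n; case/andP: (p01 n).
- near=> n; have -> : p n ^+ r = (r%:R * ln (n%:R : R) - w n) / n%:R by near: n.
  rewrite ler_wpM2r ?invr_ge0 ?ler0n // gerBl; near: n; exact: w_ge0.
apply: (@gnp_tc_aas R r r p (fun n => ((n.-1 - r) ^ r)%:R / r`!%:R)) => //.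
- near=> n; have n0 : (0 < n)%N by near: n; exact: nbhs_infty_gt.
  have [y [FF [FFc FFr FFI]]] := all_subsets_family r n0.
  exists y, FF; split=> //.
  by rewrite ler_pdivrMr ?ltr0n ?fact_gt0 // -natrM ler_nat.
pose c : R := 2^-1 ^+ r / r`!%:R.
have c0 : 0 < c by rewrite divr_gt0 ?exprn_gt0 ?ltr0n ?fact_gt0.
apply: (@ger_cvgy _ _ _ _ (fun n => c * w n)); last exact: gt0_cvgMry_seq.
near=> n; rewrite binn mul1r.
have n0 : 0 < n%:R :> R by rewrite ltr0n; near: n; exact: nbhs_infty_gt.
have -> : p n ^+ r = (r%:R * ln (n%:R : R) - w n) / n%:R by near: n.
rewrite [n%:R * _]mulrC divfK ?gt_eqF // opprB expRD expRN expRM_natl lnK ?posrE //.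
rewrite [leRHS](_ : _ = (2^-1 ^+ r / r`!%:R) * expR (w n) *
  (((n.-1 - r) ^ r)%:R / (n%:R / 2) ^+ r)); last first.
  by rewrite expr_div_n exprVn; field; rewrite !expf_neq0 ?gt_eqF //= ?pnatr_eq0 -?lt0n ?fact_gt0.
rewrite -[leLHS]mulr1; apply: ler_pM => //.
- by rewrite mulr_ge0 ?(ltW c0) //; near: n; exact: w_ge0.
- rewrite ler_wpM2l ?(ltW c0) //; have := expR_ge1Dx (w n); lra.
rewrite ler_pdivlMr ?exprn_gt0 ?divr_gt0 // mul1r natrX.
apply: lerXn2r; rewrite ?nnegrE ?divr_ge0 ?ler0n //.
rewrite ler_pdivrMr // -natrM ler_nat.
have : (2 * r.+1 <= n)%N by near: n; exact: nbhs_infty_ge.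
lia.
Unshelve. all: by end_near. Qed.

(** With about n/m disjoint [m]-sets and n C(m,r) p^r eventually at most (ln n)/2, the main term is
    at least of order n^(1/2). *)
Lemma tc_gt_aas (R : realType) (r m : nat) (p : nat -> R) :
  (0 < r <= m)%N -> (forall n, 0 <= p n <= 1) ->
  (forall e : R, 0 < e -> \forall n \near \oo,
     p n ^+ r <= e * (r%:R * ln (n%:R : R) / n%:R)) ->
  gnp_aas p (fun n G => (m < tc r G)%N).
Proof.
move=> /andP[r0 rm] p01 po; have m0 := leq_trans r0 rm.
have [||p_0 q_0] := @near_threshold R r p r0.
- by move=> n; case/andP: (p01 n).
- near=> n; rewrite -[leRHS]mul1r; near: n; exact: po.
apply: (@gnp_tc_aas R r m p (fun n => (n.-1 %/ m)%:R)) => //.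
- near=> n; have n0 : (0 < n)%N by near: n; exact: nbhs_infty_gt.
  have [|y [FF [FFc FFm FFI]]] := @disjoint_blocks m (n.-1 %/ m) n m0.
    by rewrite (leq_ltn_trans (leq_trunc_div _ _)) // prednK.
  exists y, FF; split=> [||X X' XF X'F XX'] //; first by rewrite FFc lexx.
  by rewrite (FFI _ _ XF X'F XX') cards0.
pose C : R := 'C(m, r)%:R.
have C0 : 0 < C by rewrite ltr0n bin_gt0.
have r0R : 0 < r%:R :> R by rewrite ltr0n.
have m0R : 0 < m%:R :> R by rewrite ltr0n.
pose c : R := (4 * m%:R)^-1; have c0 : 0 < c by rewrite invr_gt0 mulr_gt0.
apply: (@ger_cvgy _ _ _ _ (fun n => c * ln n%:R)); last first.
  by apply: gt0_cvgMry_seq => //; exact: cvg_ln_nat.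
(* Chosen so that n C e (r ln n / n) = (ln n)/2. *)
pose e : R := (2 * C * r%:R)^-1.
have e0 : 0 < e by rewrite invr_gt0 !mulr_gt0.
near=> n; have n0 : 0 < n%:R :> R by rewrite ltr0n; near: n; exact: nbhs_infty_gt.
have le_p : n%:R * (C * p n ^+ r) <= ln n%:R / 2.
  have : p n ^+ r <= e * (r%:R * ln n%:R / n%:R) by near: n; exact: po.
  move=> pe; apply: (@le_trans _ _ (n%:R * (C * (e * (r%:R * ln n%:R / n%:R))))).
    by rewrite ler_wpM2l ?(ltW n0) // ler_wpM2l ?(ltW C0).
  rewrite le_eqVlt; apply/orP; left; apply/eqP; rewrite /e; field.
  by rewrite !gt_eqF.
have nE : n%:R = expR (ln n%:R / 2) ^+ 2 :> R.
  by rewrite -expRM_natl mulrC divfK ?pnatr_eq0 // lnK.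
(* There are at least n/(2m) blocks once n >= 2m, and n^(1/2) >= 1 + (ln n)/2 then gives the
   constant 1/(4m). *)
apply: (@le_trans _ _ (n%:R / (2 * m%:R) * expR (- (ln n%:R / 2)))); last first.
  apply: ler_pM; rewrite ?expR_ge0 ?ler_expR ?lerN2 //.
  rewrite ler_pdivrMr ?mulr_gt0 // -!natrM ler_nat.
  have : (2 * m <= n)%N by near: n; exact: nbhs_infty_ge.
  have := divn_eq n.-1 m; have := ltn_pmod n.-1 m0; lia.
rewrite {2}nE expRN /c; have := expR_ge1Dx (ln n%:R / 2 : R).
set x := expR _ => xl; have x0 : 0 < x by exact: expR_gt0.
have -> : x ^+ 2 / (2 * m%:R) * x^-1 = (4 * m%:R)^-1 * (2 * x).
  by field; rewrite !gt_eqF.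
by rewrite ler_wpM2l ?(ltW c0) //; lra.
Unshelve. all: by end_near. Qed.

Theorem theorem1p7 (R : realType) (r : nat) (p : nat -> R) :
  (2 <= r)%N ->
  (forall n : nat, 0 <= p n <= 1) ->
  ((exists w : nat -> R,
      w n @[n --> \oo] --> +oo /\
      (\forall n \near \oo,
         0 <= r%:R * ln (n%:R : R) - w n /\
         p n = ((r%:R * ln (n%:R : R) - w n) / n%:R) `^ (r%:R^-1))) ->
   gnp_aas p (fun n G => (r < tc r G)%N))
  /\
  (p =o_\oo (fun n : nat => ((r%:R * ln (n%:R : R)) / n%:R) `^ (r%:R^-1)) ->
   forall K : nat, gnp_aas p (fun n G => (K < tc r G)%N)).
Proof.
move=> /ltnW r0 p01; split=> [[w [woo pE]]|/eqoP po K].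
  apply: (tc_gt_r_aas r0 p01 woo); apply: filterS pE => n [ge0 ->].
  by rewrite powR_invn_exprn // divr_ge0.
(* [tc_gt_aas] needs sets of size at least [r], so [K] is raised to [maxn K r]. *)
apply: (gnp_aas_mono (A := fun n G => (maxn K r < tc r G)%N)) => //.
  by move=> n G; rewrite gtn_max => /andP[].
apply: tc_gt_aas; rewrite ?r0 ?leq_maxr // => e e0.
(* The cap at 1 gives d^r <= d <= e after taking r-th powers. *)
pose d := Num.min e 1.
have d0 : 0 < d by rewrite lt_min e0 ltr01.
near=> n.
have n0 : (0 < n)%N by near: n; exact: nbhs_infty_gt.
have x0 : 0 <= r%:R * ln (n%:R : R) / n%:R.
  by rewrite divr_ge0 // mulr_ge0 // ln_ge0 // ler1n.
have le : `|p n| <= d * `|(r%:R * ln (n%:R : R) / n%:R) `^ r%:R^-1|.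
  by near: n; exact: po.
have pn0 : 0 <= p n by case/andP: (p01 n).
rewrite (ger0_norm pn0) (ger0_norm (powR_ge0 _ _)) in le.
apply: (@le_trans _ _ (d ^+ r * (r%:R * ln (n%:R : R) / n%:R))).
  rewrite -(powR_invn_exprn r0 x0) -exprMn.
  by apply: lerXn2r; rewrite ?nnegrE // mulr_ge0 ?powR_ge0 // ltW.
rewrite ler_wpM2r //; apply: (@le_trans _ _ d).
  rewrite -[leRHS]expr1 ler_wiXn2l ?(ltW d0) //.
  by rewrite ge_min lexx orbT.
by rewrite ge_min lexx.
Unshelve. all: by end_near. Qed.
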